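(* Let $X=(x_{ij})_{1\le i,j\le n}$ be an $n\times n$ matrix, let $\alpha\in\mathbb{C}$, and let $q\in\{1,\dots,n\}$. Then $$\det\nolimits^{(\alpha)}X=\sum_{p=1}^n\alpha^{1-\delta_{pq}}x_{pq}\det\nolimits^{(\alpha)}X_{pq},$$ where $\delta_{pq}$ is the Kronecker delta and $X_{pq}$ is the $(n-1)\times(n-1)$ matrix obtained by the following procedure: (1) remove the $q$-th column vector and the $q$-th row vector of $X$; (2) if $p\ne q$, then replace the row coming from the row vector $(x_{p1},\dots,x_{pn})$ of $X$ by the one coming from $(x_{q1},\dots,x_{qn})$ (with the $q$-th entry removed), in the same position.
   Context: Matrices have entries in a commutative $\mathbb{C}$-algebra. $\mathfrak{S}_n$ is the symmetric group of degree $n$ and $\nu_n(w)$ is the number of cycles of $w\in\mathfrak{S}_n$ (fixed points included). For $\alpha\in\mathbb{C}$ and $A=(a_{ij})_{1\le i,j\le n}$, $\det^{(\alpha)}A=\sum_{w\in\mathfrak{S}_n}\alpha^{n-\nu_n(w)}a_{w(1)1}\cdots a_{w(n)n}$ (with $0^0=1$; the $\alpha$-determinant of the empty matrix is $1$). *)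

(* Defs.v *)
From mathcomp Require Import all_boot all_order all_algebra all_fingroup.
From mathcomp Require Import reals complex.

Set Implicit Arguments.
Unset Strict Implicit.
Unset Printing Implicit Defensive.

Import GRing.Theory.
Local Open Scope ring_scope.

(* The orbits in [porbits w] include the singletons. *)
Definition num_cycles (n : nat) (w : 'S_n) : nat := #|porbits w|.

Definition alpha_det (K : comNzRingType) (A : comAlgType K) (alpha : K)
    (n : nat) (M : 'M[A]_n) : A :=
  \sum_(w : 'S_n) alpha ^+ (n - num_cycles w) *: \prod_(i < n) M (w i) i.

(* [lift q i] is the index in X of the row that becomes row i once row q is
   removed. *)
Definition swap_minor (T : Type) (n : nat) (X : 'M[T]_n) (p q : 'I_n) :
    'M[T]_n.-1 :=
  let Y := row' q (col' q X) in
  if p == q then Y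
  else \matrix_(i < n.-1) (if lift q i == p then col' q (row q X) else row i Y).

(* Main.v *)
Require Import Defs.
From mathcomp Require Import all_boot all_order all_algebra all_fingroup.
From mathcomp Require Import reals complex.

Set Implicit Arguments.
Unset Strict Implicit.
Unset Printing Implicit Defensive.

Import GRing.Theory.
Local Open Scope ring_scope.

(** Group the permutations [w] in the sum according to [p = w q].  Those with
    [w q = p] are exactly the [lift_perm q q u * tperm p q], where [u] permutes
    the indices other than [q]: first apply [u], fixing [q], and then exchange
    [p] and [q] ([lift_tperm_bij]).
    - In the product over [i], the index [q] contributes [X p q]; at another
      column [i], the exchange only matters when [u] sends [i] to [p], and then
      it selects row [q] in place of row [p].  This is the substitution that
      defines [swap_minor X p q] ([swap_minorE]).
    - Fixing [q] adds one cycle to [u], and for [p != q] the transposition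
      merges that cycle with the one through [p].  As the degree also increases
      by one, the exponent of [alpha] grows by [1 - (p == q)]
      ([num_cycles_lift_tperm]). *)

Lemma lift_perm_expgE n (q : 'I_n.+1) (u : 'S_n) k i :
  (lift_perm q q u ^+ k)%g (lift q i) = lift q ((u ^+ k)%g i).
Proof.
elim: k => [|k IHk]; first by rewrite !expg0 !perm1.
by rewrite !expgSr !permM IHk lift_perm_lift.
Qed.

Lemma porbit_lift_perm n (q : 'I_n.+1) (u : 'S_n) i :
  porbit (lift_perm q q u) (lift q i) = lift q @: porbit u i.
Proof.
apply/setP => x; apply/porbitP/imsetP => [[k ->]|[y /porbitP[k ->] ->]].
  by exists ((u ^+ k)%g i); rewrite ?mem_porbit ?lift_perm_expgE.
by exists k; rewrite lift_perm_expgE.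
Qed.

Lemma porbit_lift_perm_id n (q : 'I_n.+1) (u : 'S_n) :
  porbit (lift_perm q q u) q = [set q].
Proof.
apply/setP => x; rewrite inE; apply/porbitP/eqP => [[k ->]|->]; last first.
  by exists 0%N; rewrite expg0 perm1.
by elim: k => [|k IHk]; rewrite ?expg0 ?perm1 // expgSr permM IHk lift_perm_id.
Qed.

(** The cycles are [[set q]] and the images under [lift q] of those of [u]. *)
Lemma num_cycles_lift_perm n (q : 'I_n.+1) (u : 'S_n) :
  num_cycles (lift_perm q q u) = (num_cycles u).+1.
Proof.
have -> : num_cycles (lift_perm q q u) =
    #|[set q] |: [set lift q @: (B : {set 'I_n}) | B in porbits u]|.
  congr #|pred_of_set _|; apply/setP => B; rewrite !inE.
  apply/imsetP/orP => [[x _ ->]|].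
    case: (unliftP q x) => [i|] ->; last by rewrite porbit_lift_perm_id; left.
    by right; rewrite porbit_lift_perm !imset_f.
  case=> [/eqP->|/imsetP[C /imsetP[i _ ->] ->]].
    by exists q; rewrite ?porbit_lift_perm_id.
  by exists (lift q i); rewrite ?porbit_lift_perm.
rewrite cardsU1 card_imset; last exact/imset_inj/lift_inj.
suff -> : [set q] \notin [set lift q @: (B : {set 'I_n}) | B in porbits u] by [].
apply/imsetP => -[B _ /setP/(_ q)]; rewrite set11 => /esym/imsetP[i _ /eqP].
by rewrite (negPf (neq_lift q i)).
Qed.

(** In [porbits_mul_tperm] the transposition is the left factor; passing to
    inverses, which keeps the orbits, moves it there.  Since [q] is alone in its
    cycle, two cycles merge as soon as [p != q]. *)
Lemma num_cycles_lift_tperm n (p q : 'I_n.+1) (u : 'S_n) :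
  num_cycles (lift_perm q q u * tperm p q) = (num_cycles u + (p == q))%N.
Proof.
rewrite /num_cycles -porbitsV invMg tpermV lift_permV.
have := porbits_mul_tperm (lift_perm q q u^-1) p q.
rewrite /= porbit_lift_perm_id inE -/(num_cycles (lift_perm q q u^-1)).
rewrite num_cycles_lift_perm /num_cycles porbitsV.
case: (p == q) => /=; rewrite ?addn0 ?addn1 // addn2.
by case.
Qed.

Lemma num_cycles_le n (w : 'S_n) : (num_cycles w <= n)%N.
Proof. by rewrite (leq_trans (leq_imset_card _ _)) ?card_ord. Qed.

Lemma swap_minorE (T : Type) n (X : 'M[T]_n.+1) (p q : 'I_n.+1) i j :
  swap_minor X p q i j = X (tperm p q (lift q i)) (lift q j).
Proof.
rewrite /swap_minor; have [->|pq] := eqVneq p q; first by rewrite tperm1 perm1 !mxE.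
rewrite mxE; case: eqP => [->|/eqP ip]; first by rewrite tpermL !mxE.
by rewrite tpermD ?mxE ?neq_lift // eq_sym.
Qed.

Lemma lift_perm_inj n (i j : 'I_n.+1) : injective (lift_perm i j).
Proof.
move=> u v eq_uv; apply/permP => k; apply: (@lift_inj _ j).
by rewrite -!(lift_perm_lift i) eq_uv.
Qed.

(** The decomposition of a permutation is unique, since [p] is the image of [q];
    it exists by counting, as [(n + 1)! = (n + 1) * n!]. *)
Lemma lift_tperm_bij n (q : 'I_n.+1) :
  bijective (fun pu : 'I_n.+1 * 'S_n => (lift_perm q q pu.2 * tperm pu.1 q)%g).
Proof.
apply: inj_card_bij; last first.
  by rewrite card_prod card_ord !card_Sn factS.
move=> [p u] [r v] /= eq_w.
have: p = r by have /permP/(_ q) := eq_w; rewrite !permM !lift_perm_id !tpermR.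
by move: eq_w => /[swap] <- /mulIg/lift_perm_inj ->.
Qed.

Theorem propositionA1 (R : realType) (A : comAlgType R[i]) (n : nat)
    (X : 'M[A]_n) (alpha : R[i]) (q : 'I_n) :
  alpha_det alpha X =
  \sum_(p < n)
    alpha ^+ (1 - (p == q)) *: (X p q * alpha_det alpha (swap_minor X p q)).
Proof.
case: n X q => [X [] //|n X q].
rewrite {1}/alpha_det (reindex _ (onW_bij _ (lift_tperm_bij q))) /=.
pose F (w : 'S_n.+1) := alpha ^+ (n.+1 - num_cycles w) *: \prod_i X (w i) i.
rewrite -(pair_bigA _ (fun p u => F (lift_perm q q u * tperm p q)%g)) /= /F {F}.
apply: eq_bigr => p _; rewrite /alpha_det mulr_sumr scaler_sumr.
apply: eq_bigr => u _.
rewrite -scalerAr scalerA -exprD num_cycles_lift_tperm.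
congr (alpha ^+ _ *: _).
  have := num_cycles_le u.
  by case: (p == q) => le_un; rewrite ?addn1 ?subSS // addn0 subSn.
rewrite (bigD1_ord q) //= permM lift_perm_id tpermR.
congr (_ * _); apply: eq_bigr => i _.
by rewrite permM lift_perm_lift swap_minorE.
Qed.
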